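(* Let $\mathcal{A}$ be an infinite-dimensional normed algebra over $\mathbb{C}$ such that the codimension of $\mathcal{A}^2$ in $\mathcal{A}$ (that is, the dimension of the quotient vector space $\mathcal{A}/\mathcal{A}^2$) is infinite. Then $\mathcal{A}$ admits infinitely many pairwise non-equivalent algebra norms.
   Context: All algebras are associative algebras over the complex field $\mathbb{C}$, not assumed unital or commutative. An algebra norm on $\mathcal{A}$ is a vector space norm that is submultiplicative: $\|ab\| \le \|a\|\,\|b\|$ for all $a,b \in \mathcal{A}$. A normed algebra is an algebra with an algebra norm (completeness is not assumed). Two norms are equivalent if they induce the same topology. $\mathcal{A}^2 = \operatorname{span}\{ab : a,b \in \mathcal{A}\}$ is the (algebraic) linear span of all products; no closure is taken. *)

(* Defs.v *)
From HB Require Import structures.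
From mathcomp Require Export all_boot all_order all_algebra.
From mathcomp Require Export boolp classical_sets functions cardinality reals.
From mathcomp Require Export complex.
From mathcomp Require Import generic_quotient ring_quotient.

Set Implicit Arguments.
Unset Strict Implicit.
Unset Printing Implicit Defensive.

Import Order.TTheory GRing.Theory Num.Theory.

Local Open Scope classical_set_scope.
Local Open Scope quotient_scope.
Local Open Scope ring_scope.

Section Span.
Context (K : nzRingType) (V : lmodType K).

Definition linear_span (S : set V) : set V :=
  [set v | exists n (c : 'I_n -> K) (x : 'I_n -> V),
    (forall i, S (x i)) /\ v = \sum_(i < n) c i *: x i].

(* [linear_span] as a boolean predicate, to carry a [submodClosed] structure. *)
Definition spanp (S : set V) : {pred V} := [pred v | v \in linear_span S].

Lemma spanp_submod_closed S : submod_closed (spanp S).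
Proof.
split.
  rewrite inE; exists 0%N, (fun=> 0), (fun=> 0).
  by split=> [[]//|]; rewrite big_ord0.
move=> a _ _ /set_mem[m [c [x [Sx ->]]]] /set_mem[n [d [y [Sy ->]]]].
rewrite inE.
pose u (i : 'I_(m + n)) := match fintype.split i with inl j => a * c j | inr k => d k end.
pose z (i : 'I_(m + n)) := match fintype.split i with inl j => x j | inr k => y k end.
exists (m + n)%N, u, z; split=> [i|]; first by rewrite /z; case: fintype.split.
rewrite big_split_ord /= scaler_sumr; congr (_ + _); apply: eq_bigr => i _.
  by rewrite /u /z (unsplitK (inl _ i)) scalerA.
by rewrite /u /z (unsplitK (inr _ i)).
Qed.

HB.instance Definition _ S :=
  GRing.isSubmodClosed.Build K V (spanp S) (spanp_submod_closed S).

Definition infinite_dimensional : Prop :=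
  ~ exists2 B : set V, finite_set B & linear_span B = setT.

End Span.

Arguments infinite_dimensional {K} V.

(* The library provides the quotient of a module by a submodule only as an
   additive group; the scalar multiplication is added here. *)
Section QuotientSpace.
Context (K : nzRingType) (V : lmodType K) (W : submodClosed V).

(* [submodClosed] does not inherit from [zmodClosed]: over a mere semiring of
   scalars, closure under opposite is not automatic. *)
Definition submod_pred : {pred V} := W.

Lemma submod_pred_zmod_closed : zmod_closed submod_pred.
Proof.
split=> [|u v Wu Wv]; first exact: (rpred0 W).
by rewrite /submod_pred -scaleN1r; apply: (rpredD Wu); exact: (@rpredZ _ _ W (-1)).
Qed.

HB.instance Definition _ :=
  GRing.isZmodClosed.Build V submod_pred submod_pred_zmod_closed.

Local Notation Q := (Quotient.quot submod_pred).

Definition quotient_space : Type := Q.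

HB.instance Definition _ := GRing.Zmodule.on quotient_space.

Definition quotient_scale (a : K) (x : quotient_space) : quotient_space :=
  \pi_Q (a *: repr x).

Lemma quotient_scaleE a (v : V) :
  quotient_scale a (\pi_Q v) = \pi_Q (a *: v).
Proof.
apply/eqP; rewrite -Quotient.idealrBE -scalerBr.
have : repr (\pi_Q v) - v \in submod_pred.
  by rewrite Quotient.idealrBE reprK.
exact: (@rpredZ _ _ W a).
Qed.

Lemma quotient_scaleA a b v :
  quotient_scale a (quotient_scale b v) = quotient_scale (a * b) v.
Proof. by rewrite -[v](@reprK _ Q) !quotient_scaleE scalerA. Qed.

Lemma quotient_scale1 : left_id 1 quotient_scale.
Proof. by move=> v; rewrite -[v](@reprK _ Q) quotient_scaleE scale1r. Qed.

Lemma quotient_scaleDr : right_distributive quotient_scale +%R.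
Proof.
move=> a u v; rewrite -[u](@reprK _ Q) -[v](@reprK _ Q).
have piD (x y : V) : (\pi_Q x : quotient_space) + \pi_Q y =
    \pi_Q (x + y).
  by rewrite -raddfD.
by rewrite !quotient_scaleE !piD quotient_scaleE scalerDr.
Qed.

Lemma quotient_scaleDl v : {morph quotient_scale^~ v : a b / a + b}.
Proof.
move=> a b; rewrite -[v](@reprK _ Q) !quotient_scaleE scalerDl.
exact: (raddfD \pi_Q).
Qed.

HB.instance Definition _ := GRing.Zmodule_isLmodule.Build K quotient_space
  quotient_scaleA quotient_scale1 quotient_scaleDr quotient_scaleDl.

End QuotientSpace.

(* A complex associative algebra, not assumed unital, is given by an
   [R[i]]-module [A] and an associative [mul : {bilinear A -> A -> A}]. *)
Section AlgebraNorms.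
Context (R : realType) (A : lmodType R[i]).

Definition algebra_square (mul : {bilinear A -> A -> A}) : submodClosed A :=
  spanp [set mul a b | a in [set: A] & b in [set: A]].

(* The modulus [`|c|] lives in [R[i]], hence the real part. *)
Record algebra_norm (mul : {bilinear A -> A -> A}) (N : A -> R) : Prop :=
  AlgebraNorm {
    algebra_norm_ge0 : forall a, 0 <= N a;
    algebra_norm_eq0 : forall a, N a = 0 -> a = 0;
    algebra_normD : forall a b, N (a + b) <= N a + N b;
    algebra_normZ : forall (c : R[i]) a, N (c *: a) = complex.Re `|c| * N a;
    algebra_normM : forall a b, N (mul a b) <= N a * N b }.

(* Membership in the topology induced by [N]. *)
Definition norm_open (N : A -> R) (U : set A) : Prop :=
  forall x, U x -> exists2 r : R, 0 < r & forall y, N (y - x) < r -> U y.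

Definition equivalent_norms (N M : A -> R) : Prop := norm_open N = norm_open M.

End AlgebraNorms.

(* Main.v *)
Require Import Defs.
From mathcomp Require Import lra.

Set Implicit Arguments.
Unset Strict Implicit.
Unset Printing Implicit Defensive.

(** If [f] is a linear functional on [A] that vanishes on the products, hence
    on the square of [A], then [N0 + |f|] is again an algebra norm: on a product
    [ab] the extra term is zero, so submultiplicativity is inherited from [N0].
    No continuity of [f] is needed, and this leaves room for many topologies.

    As [A / A^2] is infinite dimensional, there are vectors [e n] of [A] whose
    classes modulo [A^2] are linearly independent.  For each [k], Zorn's lemma
    gives a functional [f k] on [A / A^2], pulled back to [A], with
    [f k (e n) = (n + 1)^k * N0 (e n)].  The norms [N k = N0 + |f k|] satisfy
    [N k (e n) = (1 + (n + 1)^k) * N0 (e n)], so for [j < k] the ratio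
    [N k (e n) / N j (e n)] is unbounded in [n], whereas equivalent norms
    dominate each other up to a constant ([equivalent_norms_le]).

    The two supporting facts of linear algebra are [infinite_dimensional_seq]
    (a free sequence exists in an infinite-dimensional space) and
    [functional_of_seq] (a linear functional may be prescribed on a free
    sequence). *)

Import Order.TTheory GRing.Theory Num.Theory.

Local Open Scope classical_set_scope.
Local Open Scope ring_scope.

(** * Linear functionals with prescribed values *)

Section PolynomialCombination.
Context (K : nzRingType) (W : lmodType K) (w : nat -> W).

(** The linear combination of the [w i] whose finitely supported family of
    coefficients is that of a polynomial. *)
Definition poly_comb (p : {poly K}) : W := \sum_(i < size p) p`_i *: w i.

Lemma poly_comb_widen (p : {poly K}) n : (size p <= n)%N ->
  poly_comb p = \sum_(i < n) p`_i *: w i.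
Proof.
move=> pn; rewrite /poly_comb (big_ord_widen n (fun i => p`_i *: w i)) //.
rewrite [LHS]big_mkcond; apply: eq_bigr => i _; case: ltnP => // pi.
by rewrite nth_default // scale0r.
Qed.

Lemma poly_comb_linear : linear poly_comb.
Proof.
move=> a p q; pose n := maxn (size p) (size q).
have pn : (size p <= n)%N by exact: leq_maxl.
have qn : (size q <= n)%N by exact: leq_maxr.
have apqn : (size (a *: p + q)%R <= n)%N.
  rewrite (leq_trans (size_polyD _ _)) // geq_max qn andbT.
  exact: leq_trans (size_scale_leq _ _) pn.
rewrite (poly_comb_widen pn) (poly_comb_widen qn) (poly_comb_widen apqn).
rewrite scaler_sumr -big_split; apply: eq_bigr => i _ /=.
by rewrite coefD coefZ scalerDl scalerA.
Qed.

Lemma poly_comb0 : poly_comb 0 = 0.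
Proof. by rewrite /poly_comb size_poly0 big_ord0. Qed.

Lemma poly_combXn n : poly_comb 'X^n = w n.
Proof.
rewrite /poly_comb size_polyXn big_ord_recr /= coefXn eqxx scale1r.
rewrite big1 ?add0r //.
by move=> i _; rewrite coefXn (ltn_eqF (ltn_ord i)) scale0r.
Qed.

End PolynomialCombination.

Section LinearFunctionals.
Context (K : fieldType) (V : lmodType K).

(** [G] is the graph of a linear functional defined on a subspace of [V]:
    a subspace of [V * K] on which the first projection is injective. *)
Definition linear_graph (G : set (V * K)) : Prop :=
  [/\ G (0, 0),
      forall a u v c d, G (u, c) -> G (v, d) -> G (a *: u + v, a * c + d) &
      forall c, G (0, c) -> c = 0].

(** A linear functional on a subspace extends to the whole space: a maximal
    graph is total, since otherwise it could be extended by [v |-> 0] for any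
    [v] outside its domain. *)
Lemma linear_graph_total (G0 : set (V * K)) : linear_graph G0 ->
  exists G, [/\ G0 `<=` G, linear_graph G & forall v, exists c, G (v, c)].
Proof.
move=> G0lin.
(* The empty set is admitted because [Zorn_bigcup] also ranges over the empty
   chain. *)
pose P (G : set (V * K)) := G = set0 \/ (G0 `<=` G /\ linear_graph G).
have [F FP Ftot|M [PM Mmax]] := @Zorn_bigcup _ P.
  have [[X [FX [x Xx]]]|F0] := pselect (exists X, F X /\ X !=set0); last first.
    left; rewrite -subset0 => x [X FX Xx].
    by case: F0; exists X; split=> //; exists x.
  have FE Y y : F Y -> Y y -> G0 `<=` Y /\ linear_graph Y.
    by move=> FY Yy; case: (FP _ FY) => // Y0; rewrite Y0 in Yy.
  right; have [G0X [X0 _ _]] := FE _ _ FX Xx; split; [|split].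
  - by move=> y /G0X Xy; exists X.
  - by exists X.
  - move=> a u v c d [Y FY Yu] [Z FZ Zv].
    have [_ [_ Ylin _]] := FE _ _ FY Yu; have [_ [_ Zlin _]] := FE _ _ FZ Zv.
    have [YZ|ZY] := Ftot _ _ FY FZ.
      by exists Z => //; apply: Zlin => //; exact: YZ.
    by exists Y => //; apply: Ylin => //; exact: ZY.
  - move=> c [Y FY Yc]; have [_ [_ _]] := FE _ _ FY Yc; exact.
have [G0_0 _ _] := G0lin.
case: PM => [M0|[G0M Mlin]].
  exfalso; apply: (Mmax G0); last by right; split.
  by rewrite M0; split=> [x []|/(_ _ G0_0)[]].
exists M; split=> // v; have [M0 MD Mfun] := Mlin.
apply: contrapT => vM.
pose B : set (V * K) := [set p | exists u a, M (u, p.2) /\ p.1 = u + a *: v].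
apply: (Mmax B); first split.
- by move=> [u c] Mu; exists u, 0; rewrite scale0r addr0.
- have Bv : B (v, 0) by exists 0, 1; rewrite scale1r add0r.
  by move=> /(_ _ Bv) Mv; apply: vM; exists 0.
right; split.
  by move=> [u c] /G0M Mu; exists u, 0; rewrite scale0r addr0.
split.
- by exists 0, 0; rewrite scale0r addr0.
- move=> a _ _ c d [u [b [/= Mu ->]]] [w [b' [/= Mw ->]]].
  exists (a *: u + w), (a * b + b'); split; first exact: MD.
  by rewrite /= scalerDr scalerDl scalerA addrACA.
- move=> c [u [a [/= Mu u_av]]].
  have [a0|a0] := eqVneq a 0.
    by apply: Mfun; move: Mu; rewrite a0 scale0r addr0 in u_av; rewrite -u_av.
  exfalso; apply: vM; exists (- a^-1 * c + 0).
  have -> : v = - a^-1 *: u + 0.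
    apply: (scalerI a0); rewrite addr0 scalerA mulrN divff // scaleN1r.
    by apply/eqP; rewrite -addr_eq0 addrC -u_av.
  exact: MD.
Qed.

Lemma linear_graph_functional (G0 : set (V * K)) : linear_graph G0 ->
  exists2 f : V -> K, scalar f & forall v c, G0 (v, c) -> f v = c.
Proof.
move=> /linear_graph_total[G [G0G [_ GD Gfun] /choice[f Gf]]].
have Guniq v c d : G (v, c) -> G (v, d) -> c = d.
  move=> Gc Gd; apply/esym/eqP; rewrite -subr_eq0; apply/eqP.
  have := GD (-1) v v c d Gc Gd.
  by rewrite scaleN1r addNr mulN1r addrC; exact: Gfun.
exists f => [a u v|v c /G0G]; last exact: Guniq (Gf v).
by apply: Guniq (Gf _) _; apply: GD.
Qed.

(** Linear independence of the sequence is expressed by saying that no term is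
    in the span of the previous ones. *)
Lemma infinite_dimensional_seq : infinite_dimensional V ->
  exists u : nat -> V, forall n, ~ linear_span [set u i | i in `I_n] (u n).
Proof.
move=> Vinf.
have /choice[g gP] (s : seq V) : exists v, ~ linear_span [set` s] v.
  apply: contrapT => sV; apply: Vinf; exists [set` s]; first exact: finite_seq.
  rewrite -subTset => v _; apply: contrapT => vs; apply: sV; by exists v.
pose s n := iter n (fun s => g s :: s) [::].
exists (fun n => g (s n)) => n [m [c [x [xs gE]]]].
apply: (gP (s n)); exists m, c, x; split=> // i.
have [j /= jn <-] := xs i.
elim: n jn {gE xs} => // n IHn; rewrite ltnS leq_eqVlt => /predU1P[->|/IHn] /=.
  by rewrite in_cons eqxx.
by rewrite in_cons => ->; rewrite orbT.
Qed.

Lemma functional_of_seq (u : nat -> V) (c : nat -> K) :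
  (forall n, ~ linear_span [set u i | i in `I_n] (u n)) ->
  exists2 f : V -> K, scalar f & forall n, f (u n) = c n.
Proof.
move=> ufree.
have comb_inj p : poly_comb u p = 0 -> p = 0.
  move=> pu0; apply/eqP; apply: contrapT => /negP p0.
  (* Dividing by the leading coefficient expresses [u n], where [n] is the
     degree of [p], through the previous terms. *)
  have lp0 : lead_coef p != 0 by rewrite lead_coef_eq0.
  have [n sp] : exists n, size p = n.+1.
    by exists (size p).-1; rewrite prednK // size_poly_gt0.
  apply: (ufree n); exists n.
  exists (fun i => - (lead_coef p)^-1 * p`_i), (fun i => u i).
  split=> [i|]; first by exists i => /=.
  under eq_bigr do rewrite -scalerA.
  rewrite -scaler_sumr.
  apply: (scalerI lp0); rewrite scalerA mulrN divff // scaleN1r.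
  apply/eqP; rewrite -addr_eq0 addrC; apply/eqP.
  by rewrite -[RHS]pu0 /poly_comb sp big_ord_recr /= lead_coefE sp.
(* The partial functional on the span of the [u n], given by its graph; it is
   well defined since the [u n] are linearly independent. *)
pose G0 : set (V * K) :=
  [set (poly_comb u p, poly_comb (c : nat -> K^o) p) | p in [set: {poly K}]].
have [|f flin fE] := @linear_graph_functional G0.
  split.
  - by exists 0 => //; rewrite !poly_comb0.
  - move=> a _ _ _ _ [p _ [<- <-]] [q _ [<- <-]].
    by exists (a *: p + q) => //; rewrite !poly_comb_linear.
  - by move=> _ [p _ [/comb_inj-> <-]]; rewrite poly_comb0.
exists f => // n; apply: fE; exists ('X^n) => //.
by rewrite !poly_combXn.
Qed.

End LinearFunctionals.

(** * Perturbation of an algebra norm by a functional *)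

Section Norms.
Context (R : realType) (A : lmodType R[i]) (mul : {bilinear A -> A -> A}).

Lemma Re_normD (x y : R[i]) :
  complex.Re `|x + y| <= complex.Re `|x| + complex.Re `|y|.
Proof. by have := ler_normD x y; rewrite lecE => /andP[]. Qed.

Lemma Re_normM (x y : R[i]) :
  complex.Re `|x * y| = complex.Re `|x| * complex.Re `|y|.
Proof. by rewrite normrM !normc_def /= mulr0 subr0. Qed.

Lemma Re_norm_ge0 (x : R[i]) : 0 <= complex.Re `|x|.
Proof. by rewrite normc_def /= sqrtr_ge0. Qed.

Lemma Re_normC (x : R) : complex.Re `|x%:C%C| = `|x|.
Proof. by rewrite normc_def /= expr0n /= addr0 sqrtr_sqr. Qed.

(** The norm [N + |f|]; the modulus lives in [R[i]], hence the real part. *)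
Definition perturbed_norm (N : A -> R) (f : A -> R[i]) (a : A) : R :=
  N a + complex.Re `|f a|.

Lemma perturbed_algebra_norm (N : A -> R) (f : A -> R[i]) :
  algebra_norm mul N -> scalar f -> (forall a b, f (mul a b) = 0) ->
  algebra_norm mul (perturbed_norm N f).
Proof.
move=> [N_ge0 N_eq0 ND NZ NM] flin fmul.
have f0 : f 0 = 0.
  by have := flin (-1) 0 0; rewrite scaleN1r addNr mulN1r addNr.
split; rewrite /perturbed_norm.
- by move=> a; rewrite addr_ge0 // Re_norm_ge0.
- move=> a Na0; apply: N_eq0; apply/eqP; rewrite eq_le N_ge0 andbT.
  by rewrite -Na0 lerDl Re_norm_ge0.
- move=> a b; have := flin 1 a b; rewrite scale1r mul1r => ->.
  by rewrite addrACA lerD // Re_normD.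
- move=> c a; have := flin c a 0; rewrite addr0 f0 addr0 => ->.
  by rewrite NZ Re_normM mulrDr.
- move=> a b; rewrite fmul normr0 addr0; apply: (le_trans (NM a b)).
  by rewrite ler_pM // lerDl Re_norm_ge0.
Qed.

Lemma algebra_norm0 (N : A -> R) : algebra_norm mul N -> N 0 = 0.
Proof.
by move=> Nn; rewrite -[0 in LHS](scale0r 0) (algebra_normZ Nn) normr0 mul0r.
Qed.

(** The open unit ball of [M] is open for [N], hence contains a ball of [N]
    centred at the origin; the bound follows by homogeneity. *)
Lemma equivalent_norms_le (N M : A -> R) :
  algebra_norm mul N -> algebra_norm mul M -> equivalent_norms N M ->
  exists2 r : R, 0 < r & forall a, r * M a <= N a.
Proof.
move=> Nn Mn NM.
have Mball : norm_open M [set a | M a < 1].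
  move=> x /= Mx; exists (1 - M x) => [|y yx]; first by rewrite subr_gt0.
  rewrite -(subrK x y); apply: le_lt_trans (algebra_normD Mn _ _) _.
  by rewrite -ltrBrDr.
rewrite -NM in Mball.
have [|r r0 rP] := Mball 0; first by rewrite /= (algebra_norm0 Mn).
exists r => // a.
have := algebra_norm_ge0 Mn a; rewrite le_eqVlt => /predU1P[<-|Ma0].
  by rewrite mulr0 (algebra_norm_ge0 Nn).
rewrite leNgt; apply/negP => Na.
(* Rescaled to [M]-norm one, [a] is in the [N]-ball but not in the [M]-ball. *)
pose t : R[i] := ((M a)^-1)%:C%C.
have tE : complex.Re `|t| = (M a)^-1.
  by rewrite Re_normC gtr0_norm // invr_gt0.
have := rP (t *: a); rewrite subr0 /= (algebra_normZ Nn) (algebra_normZ Mn) tE.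
rewrite mulVf ?gt_eqF // ltxx => rP'.
by suff : false by []; apply: rP'; rewrite mulrC ltr_pdivrMr.
Qed.

End Norms.

(** * Infinitely many inequivalent norms *)

Theorem corollary2p5 (R : realType) (A : lmodType R[i])
    (mul : {bilinear A -> A -> A}) (mulA : associative mul)
    (N0 : A -> R) (N0_norm : algebra_norm mul N0)
    (A_infinite : infinite_dimensional A)
    (codim_infinite : infinite_dimensional (quotient_space (algebra_square mul))) :
  exists F : set (A -> R),
    [/\ infinite_set F,
        (forall N, F N -> algebra_norm mul N) &
        (forall N M, F N -> F M -> N <> M -> ~ equivalent_norms N M)].
Proof.
pose Q := quotient_space (algebra_square mul).
pose W := submod_pred (algebra_square mul).
(* The canonical projection onto [A / A^2]. *)
pose pr (a : A) : Q := \pi_(Quotient.quot W)%qT a.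
have pr_lin c a b : pr (c *: a + b) = c *: pr a + pr b.
  rewrite /pr raddfD; congr (_ + _); exact/esym/quotient_scaleE.
have pr_mul a b : pr (mul a b) = 0.
  rewrite /pr; apply/eqP; rewrite -(raddf0 (\pi_(Quotient.quot W)%qT)).
  rewrite -Quotient.idealrBE subr0 /W /submod_pred /algebra_square inE.
  exists 1%N, (fun=> 1), (fun=> mul a b); split=> [_|].
    by exists a => //; exists b.
  by rewrite big_ord1 scale1r.
have [u ufree] := infinite_dimensional_seq codim_infinite.
pose e n : A := repr (u n).
have pre n : pr (e n) = u n by rewrite /pr /e reprK.
have e_gt0 n : 0 < N0 (e n).
  rewrite lt_neqAle eq_sym (algebra_norm_ge0 N0_norm) andbT.
  apply/eqP => /(algebra_norm_eq0 N0_norm) e0; apply: (ufree n).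
  exists 0%N, (fun=> 0), (fun=> 0); split=> [[]//|].
  by rewrite big_ord0 -pre e0 /pr raddf0.
have /choice[f fP] (k : nat) : exists f : A -> R[i],
    [/\ scalar f, forall a b, f (mul a b) = 0 &
        forall n, f (e n) = ((n.+1%:R ^+ k * N0 (e n))%:C)%C].
  have [g glin gu] := functional_of_seq
    (fun n => ((n.+1%:R ^+ k * N0 (e n))%:C)%C) ufree.
  exists (g \o pr); split=> [c a b|a b|n] /=.
  - by rewrite pr_lin glin.
  - rewrite pr_mul; have := glin (-1) 0 0.
    by rewrite scaleN1r addNr mulN1r addNr.
  - by rewrite pre gu.
pose N k := perturbed_norm N0 (f k).
have Nn k : algebra_norm mul (N k).
  by have [flin fmul _] := fP k; exact: perturbed_algebra_norm.
have Ne k n : N k (e n) = (1 + n.+1%:R ^+ k) * N0 (e n).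
  rewrite /N /perturbed_norm; have [_ _ ->] := fP k.
  rewrite Re_normC ger0_norm ?mulr_ge0 ?exprn_ge0 // ?ltW //.
  by rewrite mulrDl mul1r.
have Nlt j k : (j < k)%N -> ~ equivalent_norms (N j) (N k).
  move=> jk /(equivalent_norms_le (Nn j) (Nn k))[r r0 rN].
  have [n rn] : exists n : nat, 2 / r < n.+1%:R.
    exists (Num.bound (2 / r)).
    apply: lt_trans (archi_boundP _) _; last by rewrite ltr_nat.
    by rewrite divr_ge0 // ltW.
  (* As [(n + 1)^k >= (n + 1) * (n + 1)^j] and [r * (n + 1) > 2], the term
     [r * (n + 1)^k] exceeds [2 * (n + 1)^j >= 1 + (n + 1)^j]. *)
  have := rN (e n); rewrite !Ne mulrA ler_pM2r //.
  apply/negP; rewrite -ltNge.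
  set x : R := n.+1%:R.
  have x1 : 1 <= x by rewrite ler1n.
  have xj1 : 1 <= x ^+ j by rewrite exprn_ege1.
  have xjk : x ^+ j.+1 <= x ^+ k by rewrite ler_weXn2l.
  have rx : 2 < r * x by rewrite mulrC -ltr_pdivrMr.
  rewrite exprS in xjk; nra.
have Nne j k : j <> k -> ~ equivalent_norms (N j) (N k).
  move=> /eqP; rewrite neq_ltn => /orP[]; first exact: Nlt.
  by move=> /Nlt kj /esym.
exists (range N); split.
- have Ninj : injective N.
    move=> j k jk; apply: contrapT => /Nne; apply.
    by rewrite /equivalent_norms jk.
  rewrite (eq_finite_set (inj_card_eq (in2W Ninj))).
  exact: infinite_nat.
- by move=> _ [k _ <-].
- move=> _ _ [j _ <-] [k _ <-] jk; apply: Nne => jk'.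
  by apply: jk; rewrite jk'.
Qed.
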